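(* Let $D$ be an infinite discrete space and let $\alpha D$ be its one-point compactification. Then (1) $\mathrm{cs}^*_\chi(\alpha D)=\min\{w(X): X$ is a $T_1$ topological space of size $|X|=|D|$ containing no non-trivial convergent sequence$\}$, and the same equality holds when the minimum is taken only over regular zero-dimensional $T_1$ spaces $X$ with these properties; (2) $\mathrm{cs}_\chi(\alpha D)=\min\{w(X): X$ is a $T_1$ topological space of size $|X|=|D|$ containing no countable non-discrete subspace$\}$, and the same equality holds when the minimum is taken only over regular zero-dimensional $T_1$ spaces $X$ with these properties.
   Context: A family $\mathcal N$ of subsets of $X$ is a $\mathrm{cs}$-network (resp. $\mathrm{cs}^*$-network) at $x\in X$ if for every neighborhood $U$ of $x$ and every sequence $(x_n)\subset X$ convergent to $x$ there is $N\in\mathcal N$ with $N\subset U$ such that $x_n\in N$ for all but finitely many (resp. for infinitely many) $n$. $\mathrm{cs}_\chi(X)$ (resp. $\mathrm{cs}^*_\chi(X)$) is the supremum over $x\in X$ of the smallest size of a $\mathrm{cs}$-network (resp. $\mathrm{cs}^*$-network) at $x$. $w(X)$ is the weight of $X$ (the smallest size of a base of the topology). A convergent sequence is trivial if it is eventually constant. A space is zero-dimensional if it has a base of open-and-closed sets. *)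

(* Defs.v *)
From HB Require Import structures.
From mathcomp Require Import all_boot all_order all_algebra.
From mathcomp Require Import all_classical all_reals all_analysis.

Set Implicit Arguments.
Unset Strict Implicit.
Unset Printing Implicit Defensive.

Local Open Scope classical_set_scope.
Local Open Scope card_scope.

(* Cardinals are represented by types up to equipotence, and a class of
   cardinals by a predicate on types.  A cardinal invariant is a predicate
   holding exactly at the types whose cardinality is its value (see
   [least_card_unique] for uniqueness). *)
Definition least_card (C : Type -> Prop) (K : Type) : Prop :=
  C K /\ forall L : Type, C L -> [set: K] #<= [set: L].

Lemma least_card_unique (C : Type -> Prop) (K L : Type) :
  least_card C K -> least_card C L -> [set: K] #= [set: L].
Proof.
by move=> [CK minK] [CL minL]; rewrite card_eq_le minK ?minL.
Qed.

Definition min_size (T : Type) (P : set T -> Prop) : Type -> Prop :=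
  least_card (fun K => exists2 N : set T, P N & N #= [set: K]).

Definition sup_card (I : Type) (c : I -> Type -> Prop) : Type -> Prop :=
  least_card (fun L => forall i M, c i M -> [set: M] #<= [set: L]).

Section cardinal_invariants.
Variable X : topologicalType.

Definition cs_network (x : X) (N : set (set X)) : Prop :=
  forall (U : set X) (x_ : nat -> X), nbhs x U -> x_ @ \oo --> x ->
    exists A, [/\ N A, A `<=` U & cofinite_set [set n | A (x_ n)]].

Definition cs_star_network (x : X) (N : set (set X)) : Prop :=
  forall (U : set X) (x_ : nat -> X), nbhs x U -> x_ @ \oo --> x ->
    exists A, [/\ N A, A `<=` U & infinite_set [set n | A (x_ n)]].

Definition cs_character : Type -> Prop :=
  sup_card (fun x : X => min_size (cs_network x)).

Definition cs_star_character : Type -> Prop :=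
  sup_card (fun x : X => min_size (cs_star_network x)).

Definition weight : Type -> Prop := min_size (@basis X).

(* The limit need not be unique in a T1 space; triviality concerns the sequence
   only. *)
Definition no_nontrivial_convergent_sequence : Prop :=
  forall (x_ : nat -> X) (x : X), x_ @ \oo --> x ->
    exists y : X, \forall n \near \oo, x_ n = y.

Definition discrete_space : Prop := @nbhs X X = principal_filter.

(* Stronger than the library's [zero_dimensional], which only asks that
   distinct points be separated by a clopen set. *)
Definition has_clopen_basis : Prop :=
  exists2 B : set (set X), basis B & B `<=` clopen.

End cardinal_invariants.

(* [set_type A] carries the topology induced from X. *)
Definition no_countable_nondiscrete_subspace (X : topologicalType) : Prop :=
  forall A : set X, countable A -> discrete_space (set_type A).

Definition min_weight (P : topologicalType -> Prop) : Type -> Prop :=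
  least_card (fun K => exists2 X : topologicalType, P X & weight X K).

(* Main.v *)
(* A sequence of alpha D converges to infinity iff it takes each value in D
   finitely often, so only the character at infinity matters.

   Given a cs*-network N at infinity, two points of D lying in the same members
   of N are called indistinguishable; an infinite class of such points would
   contain an injective sequence converging to infinity that N cannot separate
   from one of the points of the class.  Hence classes are finite, and some
   lev : D -> nat is injective on each of them.  The sets A, D \ A (A in N) and
   the level sets of lev generate a topology on D with a clopen base of size
   |N|.  For every x, an injective sequence has infinitely many (for a
   cs-network: almost all) terms in some A in N missing x, i.e. outside the
   neighborhood D \ A of x, so x is not its limit (resp. not an accumulation
   point of its range).

   Conversely, if B is a base of a T1 topology on D with the required property,
   the complements in alpha D of finite unions of members of B form a network
   at infinity: every point of D has a basic neighborhood avoiding infinitely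
   many (resp. almost all) terms of a given sequence converging to infinity. *)

Require Import Defs.
From HB Require Import structures.
From mathcomp Require Import all_boot all_order all_algebra.
From mathcomp Require Import all_classical all_reals all_analysis.

Set Implicit Arguments.
Unset Strict Implicit.
Unset Printing Implicit Defensive.

Local Open Scope classical_set_scope.
Local Open Scope card_scope.

(** * Cardinal comparison *)

Lemma card_leT_injP (A B : Type) :
  [set: A] #<= [set: B] <-> exists f : A -> B, injective f.
Proof.
split=> [/card_leP[f]|[f f_inj]].
  have f_inj : set_inj [set: A]
      (fun a => val (f (SigSub (mem_set (I : setT a))))).
    move=> a b _ _ /val_inj /(@inj _ _ _ f).
    by rewrite !inE => /(_ I I) [].
  exists (fun a => val (f (SigSub (mem_set (I : setT a))))).
  by move=> a b; apply: f_inj; rewrite inE.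
have := inj_card_eq (in2W f_inj : {in [set: A] &, injective f}).
rewrite card_eq_le => /andP[_ /card_le_trans]; apply.
exact: card_leT.
Qed.

(** Replaces the injection between subtypes behind [#<=] by a total function; [u0] is its value
    outside [A]. *)
Lemma card_le_fun (T U : Type) (u0 : U) (A : set T) (B : set U) : A #<= B ->
  exists f : T -> U, (forall x, A x -> B (f x)) /\
    (forall x y, A x -> A y -> f x = f y -> x = y).
Proof.
rewrite -(card_le_eql (card_setT A)) -(card_le_eqr (card_setT B)).
move=> /card_leT_injP[k k_inj].
have /choice[f fP] : forall x, exists u, forall a : set_type A,
    val a = x -> u = val (k a).
  move=> x; have [Ax|nAx] := pselect (A x).
    exists (val (k (SigSub (mem_set Ax)))) => a ax.
    by congr (val (k _)); apply: val_inj; rewrite ax.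
  by exists u0 => a ax; case: nAx; rewrite -ax; exact: set_valP.
have fE x (Ax : A x) : f x = val (k (SigSub (mem_set Ax))) by exact: fP.
exists f; split=> [x Ax|x y Ax Ay]; first by rewrite (fE _ Ax); exact: set_valP.
by rewrite (fE _ Ax) (fE _ Ay) => /val_inj/k_inj[].
Qed.

(* Zorn on sets of sections any two of which differ in every coordinate: for a
   maximal such set some coordinate map is onto, hence bijective, and the other
   coordinate maps are injective. *)
Lemma exists_least_type (I : Type) (T : I -> Type) : inhabited I ->
  exists i, forall j, [set: T i] #<= [set: T j].
Proof.
move=> [i0].
pose P (S : set (forall i, T i)) :=
  forall s t, S s -> S t -> (exists i, s i = t i) -> s = t.
have [F FP totF|S [PS maxS]] := @Zorn_bigcup _ P.
  move=> s t [A FA As] [B FB Bt].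
  have [AB|BA] := totF _ _ FA FB.
    by apply: (FP _ FB) => //; exact: AB.
  by apply: (FP _ FA) => //; exact: BA.
have [i coverS] : exists i, forall y : T i, exists2 s, S s & s i = y.
  (* If no coordinate map were onto, choosing a missed value in every coordinate would give a
     section [z] differing everywhere from all of [S], against maximality. *)
  apply: contrapT => /forallNP notcover.
  have uncovered i : exists y : T i, forall s, S s -> s i <> y.
    have /existsNP[y ny] := notcover i.
    by exists y => s Ss siy; apply: ny; exists s.
  pose z i := sval (cid (uncovered i)).
  have zP s : S s -> forall i, s i <> z i.
    by move=> Ss i; exact: (svalP (cid (uncovered i))).
  apply: (maxS (z |` S)).
    split=> [|/(_ z (or_introl erefl)) /zP /(_ i0)//].
    exact: subsetUr.
  by move=> s t [->|Ss] [->|St] [i e] //;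
    [case: (zP t St i)|case: (zP s Ss i)|apply: PS => //; exists i].
have /choice[s sP] : forall y, exists s, S s /\ s i = y.
  by move=> y; have [s] := coverS y; exists s.
exists i => j; apply/card_leT_injP; exists (fun y => s y j) => y z syz.
have [[Sy <-] [Sz <-]] := (sP y, sP z).
by rewrite (PS _ _ Sy Sz) //; exists j.
Qed.

Lemma card_le_total (A B : Type) :
  [set: A] #<= [set: B] \/ [set: B] #<= [set: A].
Proof.
have [[|] least] :=
    exists_least_type (fun b : bool => if b then A else B) (inhabits true).
  by left; exact: least false.
by right; exact: least true.
Qed.

(** * Arithmetic of infinite cardinals *)

Lemma infinite_type_injP (A : Type) :
  infinite_set [set: A] <-> exists f : nat -> A, injective f.
Proof. by rewrite infiniteP card_leT_injP. Qed.

(* Partial injections [pdom x pdom -> pdom], for Zorn's lemma in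
   [card_le_square]. *)
Record pairing (K : Type) := Pairing {
  pdom : set K;
  pfun : K -> K -> K;
  pfun_dom : forall x y, pdom x -> pdom y -> pdom (pfun x y);
  pfun_inj : forall x y x' y', pdom x -> pdom y -> pdom x' -> pdom y' ->
    pfun x y = pfun x' y' -> x = x' /\ y = y';
  pdom_infinite : infinite_set pdom }.

Definition pairing_le K (p q : pairing K) : Prop := pdom p `<=` pdom q /\
  forall x y, pdom p x -> pdom p y -> pfun p x y = pfun q x y.

(** Starting point for Zorn's lemma: a copy of [nat] in [K] inherits the pairing of natural
    numbers. *)
Lemma pairing_exists K : infinite_set [set: K] -> inhabited (pairing K).
Proof.
move=> /infinite_type_injP[e e_inj].
have [c c_inj] : exists c : nat * nat -> nat, injective c.
  by exists pickle; exact: pcan_inj pickleK.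
have [r rK] : exists r : K -> nat, cancel e r.
  have /choice[r rP] : forall k, exists n, range e k -> e n = k.
    by move=> k; have [[n _ <-]|] := pselect (range e k); [exists n|exists 0%N].
  by exists r => n; apply/e_inj/rP; exists n.
exists; apply: (@Pairing _ (range e) (fun x y => e (c (r x, r y)))).
- by move=> x y _ _; eexists.
- by move=> _ _ _ _ [a _ <-] [b _ <-] [a' _ <-] [b' _ <-];
    rewrite !rK => /e_inj/c_inj[-> ->].
- move=> /(sub_finite_set _) fin; apply: infinite_nat.
  have := inj_card_eq (in2W e_inj : {in [set: nat] &, injective e}).
  by move=> /eq_finite_set <-; apply: fin.
Qed.

(** The upper bound is the union of the chain. Any four points of the union lie in the domain of one
    member, so injectivity, which involves four points, is inherited. *)
Lemma pairing_chain K (F : set (pairing K)) : F !=set0 ->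
  total_on F (@pairing_le K) -> exists p, forall q, F q -> pairing_le q p.
Proof.
move=> [q0 Fq0] totF.
pose A := \bigcup_(q in F) pdom q.
have /choice[g gP] : forall xy : K * K, exists z, forall q, F q ->
    pdom q xy.1 -> pdom q xy.2 -> pfun q xy.1 xy.2 = z.
  move=> [x y]/=; have [[q [Fq qx qy]]|noq] :=
      pselect (exists q, [/\ F q, pdom q x & pdom q y]); last first.
    by exists x => q Fq qx qy; case: noq; exists q.
  exists (pfun q x y) => q' Fq' q'x q'y.
  by have [[_ ->]|[_ ->]] := totF _ _ Fq Fq'.
have two x y : A x -> A y -> exists q, [/\ F q, pdom q x & pdom q y].
  move=> [p Fp px] [q Fq qy].
  have [[pq _]|[qp _]] := totF _ _ Fp Fq.
    by exists q; split => //; exact: pq.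
  by exists p; split => //; exact: qp.
have four x y x' y' : A x -> A y -> A x' -> A y' ->
    exists q, [/\ F q, pdom q x, pdom q y, pdom q x' & pdom q y'].
  move=> Ax Ay Ax' Ay'.
  have [[p [Fp px py]] [q [Fq qx' qy']]] := (two _ _ Ax Ay, two _ _ Ax' Ay').
  have [[pq _]|[qp _]] := totF _ _ Fp Fq.
    by exists q; split => //; exact: pq.
  by exists p; split => //; exact: qp.
unshelve eexists (@Pairing _ A (fun x y => g (x, y)) _ _ _).
- move=> x y Ax Ay; have [q [Fq qx qy]] := two _ _ Ax Ay.
  by exists q => //; rewrite -(gP (x, y) q)//=; exact: pfun_dom.
- move=> x y x' y' Ax Ay Ax' Ay'.
  have [q [Fq qx qy qx' qy']] := four _ _ _ _ Ax Ay Ax' Ay'.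
  by rewrite -(gP (x, y) q)// -(gP (x', y') q)//=; exact: pfun_inj.
- by apply: sub_infinite_set (@pdom_infinite _ q0) => x q0x; exists q0.
- move=> q Fq; split=> [x qx|x y qx qy]; first by exists q.
  exact: (gP (x, y)).
Qed.

(** Let [A] be the domain of a maximal pairing. If the complement of [A] embeds into [A], then so
    does [K], and the pairing on [A] serves for [K]. Otherwise [A] embeds by [h] into its
    complement, and the pairing extends to [A] together with its image, against maximality. *)
Lemma card_le_square K : infinite_set [set: K] -> [set: K * K] #<= [set: K].
Proof.
move=> K_infinite; have [p0] := pairing_exists K_infinite.
have [|p' q' r'|F totF|p maxp] :=
    @ZL_preorder _ p0 (fun p q => `[< pairing_le p q >]).
- by move=> p; apply/asboolP; split.
- move=> /asboolP[pq pqE] /asboolP[qr qrE]; apply/asboolP; split.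
    exact: subset_trans qr.
  by move=> x y px py; rewrite pqE// qrE//; exact: pq.
- have [->|/set0P/pairing_chain ub] := eqVneq F set0; first by exists p0.
  have [|p pub] := ub; last by exists p => q /pub/asboolP.
  by move=> s t Fs Ft; have [/asboolP|/asboolP] := totF _ _ Fs Ft; [left|right].
pose A := pdom p; pose g := pfun p.
have [c [cA c_inj]] : exists c : nat -> K, (forall n, A (c n)) /\ injective c.
  have /infiniteP := @pdom_infinite _ p.
  rewrite -(card_le_eqr (card_setT (pdom p))) => /card_leT_injP[c c_inj].
  exists (fun n => val (c n)); split=> [n|m n /val_inj/c_inj//].
  exact: set_valP.
have gA x y : A x -> A y -> A (g x y) by exact: pfun_dom.
have g_inj x y x' y' : A x -> A y -> A x' -> A y' ->
    g x y = g x' y' -> x = x' /\ y = y' by exact: pfun_inj.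
have [[f [fA f_inj]]|[h [hA h_inj]]] :
    (exists f : K -> K, (forall x, A (f x)) /\ injective f) \/
    (exists h : K -> K, (forall x, A x -> ~ A (h x)) /\
      forall x y, A x -> A y -> h x = h y -> x = y).
  have [] := card_le_total (set_type A) (set_type (~` A));
    rewrite (card_le_eql (card_setT _)) (card_le_eqr (card_setT _)).
    by move=> /(card_le_fun (c 0%N))[h [hA h_inj]]; right; exists h.
  move=> /(card_le_fun (c 0%N))[k [kA k_inj]]; left.
  (* The tags [c 0] and [c 1] keep the images of [A] and of its complement disjoint. *)
  pose f x := if `[< A x >] then g (c 0%N) x else g (c 1%N) (k x).
  exists f; split=> [x|x y]; rewrite /f.
    by case: asboolP => [Ax|/kA Akx]; exact: gA.
  by case: asboolP => [Ax|nAx]; case: asboolP => [Ay|nAy];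
    move=> /g_inj[] //; do ?[exact: kA]; do ?[by move=> /c_inj];
    move=> _ /k_inj; apply.
- apply/card_leT_injP; exists (fun xy => g (f xy.1) (f xy.2)).
  by move=> [x y] [x' y'] /= /g_inj[]// /f_inj-> /f_inj->.
exfalso.
(* [p] extends to [A `|` h @` A]: a pair outside A is sent into [h @` A], its
   components being pulled back to A and tagged by their membership in A. *)
have /choice[r rP] : forall u, exists x, forall a, A a -> h a = u -> x = a.
  move=> u; have [[a Aa <-]|no] := pselect (exists2 a, A a & h a = u).
    by exists a => b Ab /h_inj->.
  by exists u => a Aa ha; case: no; exists a.
have hK a : A a -> r (h a) = a by move=> Aa; exact: rP.
pose back u := if `[< A u >] then u else r u.
pose B := A `|` h @` A.
have backA u : B u -> A (back u).
  by rewrite /back; case: asboolP => // nAu [//|[a Aa <-]]; rewrite hK.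
have back_inj u v : B u -> B v -> `[< A u >] = `[< A v >] ->
    back u = back v -> u = v.
  rewrite /back; case: asboolP => [Au|nAu]; case: asboolP => [Av|nAv] //.
  by move=> [//|[a Aa <-]] [//|[b Ab <-]] _; rewrite !hK// => ->.
pose code u v := c (`[< A u >] + 2 * `[< A v >])%N.
pose G u v := if `[< A u >] && `[< A v >] then g u v
  else h (g (code u v) (g (back u) (back v))).
have inA u v : B u -> B v -> A (g (code u v) (g (back u) (back v))).
  by move=> /backA Au /backA Av; apply: (gA); [exact: cA|exact: gA].
have GB x y : B x -> B y -> B (G x y).
  move=> Bx By; rewrite /G; case: ifPn => [/andP[/asboolP Ax /asboolP Ay]|_].
    by left; exact: gA.
  by right; exact: (imageP h (inA _ _ Bx By)).
have G_inj x y x' y' : B x -> B y -> B x' -> B y' ->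
    G x y = G x' y' -> x = x' /\ y = y'.
  move=> Bx By Bx' By'; rewrite /G.
  case: ifPn => [/andP[/asboolP Ax /asboolP Ay]|_].
    case: ifPn => [/andP[/asboolP Ax' /asboolP Ay']|_]; first exact: g_inj.
    by move=> e; case: (hA _ (inA _ _ Bx' By')); rewrite -e; exact: gA.
  case: ifPn => [/andP[/asboolP Ax' /asboolP Ay']|_].
    by move=> e; case: (hA _ (inA _ _ Bx By)); rewrite e; exact: gA.
  move=> /(h_inj _ _ (inA _ _ Bx By) (inA _ _ Bx' By')).
  move=> /g_inj[]; rewrite ?{1}/code//; do ?[exact/gA/backA|exact: backA].
    by apply: gA; exact: backA.
    by apply: gA; exact: backA.
  move=> /c_inj codeE /g_inj[]; do ?[exact: backA].
  move=> xx' yy'.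
  have [eA eA'] : `[< A x >] = `[< A x' >] /\ `[< A y >] = `[< A y' >].
    by move: codeE; do 4!case: asbool.
  by split; apply: back_inj.
have B_infinite : infinite_set B.
  by apply: sub_infinite_set (@pdom_infinite _ p); exact: subsetUl.
have /maxp/asboolP[BA _] : `[< pairing_le p (Pairing GB G_inj B_infinite) >].
  apply/asboolP; split=> /= [|x y Ax Ay]; first exact: subsetUl.
  by rewrite /G !asboolT.
by apply: (hA (c 0%N)) => //; apply: BA; right; exists (c 0%N).
Qed.

Lemma card_le_map (A B : Type) (f : A -> B) : injective f ->
  [set: A] #<= [set: B].
Proof. by move=> f_inj; apply/card_leT_injP; exists f. Qed.

Lemma card_le_prod (A B K : Type) : infinite_set [set: K] ->
  [set: A] #<= [set: K] -> [set: B] #<= [set: K] -> [set: A * B] #<= [set: K].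
Proof.
move=> /card_le_square KK /card_leT_injP[f f_inj] /card_leT_injP[g g_inj].
apply: card_le_trans KK.
apply: (@card_le_map _ _ (fun ab => (f ab.1, g ab.2))).
by move=> [a b] [a' b'] [/f_inj-> /g_inj->].
Qed.

Lemma card_le_nat (A : countType) (K : Type) : infinite_set [set: K] ->
  [set: A] #<= [set: K].
Proof. by move=> /infiniteP; apply: card_le_trans; exact: countableP. Qed.

Lemma card_le_sum (A B K : Type) : infinite_set [set: K] ->
  [set: A] #<= [set: K] -> [set: B] #<= [set: K] -> [set: A + B] #<= [set: K].
Proof.
move=> K_infinite /card_leT_injP[f f_inj] /card_leT_injP[g g_inj].
have bool_le := card_le_nat bool K_infinite.
apply: card_le_trans (card_le_prod K_infinite bool_le (card_lexx _)).
apply: (@card_le_map _ _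
  (fun s => match s with inl a => (true, f a) | inr b => (false, g b) end)).
by move=> [a|b] [a'|b'] [] //; [move/f_inj->|move/g_inj->].
Qed.

(** A list is recovered from its length and the iterated pairing of its entries; the pairing alone
    need not reveal the length. *)
Lemma card_le_seq (A K : Type) : infinite_set [set: K] ->
  [set: A] #<= [set: K] -> [set: seq A] #<= [set: K].
Proof.
move=> K_infinite /card_leT_injP[f f_inj].
have /card_leT_injP[g g_inj] := card_le_square K_infinite.
have [/(_ 0%N) k0 _] := iffLR (infinite_type_injP K) K_infinite.
pose code := foldr (fun x y => g (f x, y)) k0.
have code_inj s t : size s = size t -> code s = code t -> s = t.
  by elim: s t => [|x s IHs] [|y t] //= [st] /g_inj[/f_inj-> /(IHs _ st)->].
have nat_le := card_le_nat nat K_infinite.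
apply: card_le_trans (card_le_prod K_infinite nat_le (card_lexx _)).
apply: (@card_le_map _ _ (fun s => (size s, code s))).
by move=> s t [/code_inj]; exact.
Qed.

Lemma finite_powerset (T : Type) :
  finite_set [set: T] -> finite_set [set: set T].
Proof.
move=> /finite_set_leP[n]; rewrite (card_le_eqr card_II).
move=> /card_leT_injP[f f_inj].
pose F (A : set T) : {set 'I_n} := [set i | `[< (f @` A) i >]]%SET.
have F_inj : injective F.
  move=> A B AB; have {}AB i : (f @` A) i <-> (f @` B) i.
    by move/setP/(_ i): AB; rewrite !inE; exact: asbool_eq_equiv.
  apply/seteqP; split=> x xAB.
    by have /AB[y By /f_inj<-] := imageP f xAB.
  by have /AB[y By /f_inj<-] := imageP f xAB.
exact: card_le_finite (card_le_map F_inj) finite_finset.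
Qed.

Lemma infinite_fiber (A B : Type) (f : A -> B) : infinite_set [set: A] ->
  finite_set [set: B] -> exists b, infinite_set (f @^-1` [set b]).
Proof.
move=> A_infinite B_finite; apply: contrapT => /forallNP fib.
apply: A_infinite; rewrite (_ : setT = \bigcup_b (f @^-1` [set b])).
  by apply: bigcup_finite => // b _; exact: contrapT (fib b).
by apply/seteqP; split=> // a _; exists (f a).
Qed.

(** * Convergence to infinity *)

Lemma near_oo_cofinite (P : set nat) :
  (\forall n \near \oo, P n) <-> cofinite_set P.
Proof.
split=> [[N _ NP]|finP].
  apply: sub_finite_set (finite_II N) => n nP; rewrite /= ltnNge.
  by apply/negP => /NP.
have [N NP] : exists N, forall n, ~ P n -> (n < N)%N.
  have /finite_seqP[s sE] := finP.
  exists (\max_(n <- s) n).+1 => n nP; rewrite ltnS.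
  have ns : [set` s] n by rewrite -sE.
  exact: (@leq_bigmax_seq _ s xpredT id n).
by exists N => // n /= Nn; apply: contrapT => /NP; rewrite ltnNge Nn.
Qed.

(** For infinite [A], the filter of sets missing finitely many points of [A] is proper without
    cluster point [p] in [A]: it contains [A] minus [p], disjoint from the neighborhood
    [[set p]]. *)
Lemma discrete_compact_finite (D : discreteTopologicalType) (A : set D) :
  compact A <-> finite_set A.
Proof.
split=> [A_compact|]; last exact: finite_compact.
apply: contrapT => A_infinite.
pose F : set_system D := [set U | finite_set (A `\` U)].
have F_filter : ProperFilter F.
  split; first by rewrite /F /= setD0.
  split; rewrite /F /=.
  - by rewrite setDT.
  - by move=> U V AU AV; rewrite /= setDIr finite_setU.
  - by move=> U V UV; apply: sub_finite_set; exact: setDS.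
have [|p [Ap clp]] := A_compact F F_filter.
  by rewrite /F /= setDv.
have [||q [[]]] := clp (A `\` [set p]) [set p] => //.
  by apply: sub_finite_set (finite_set1 p) => x [Ax /not_andP[|/contrapT]].
exact: discrete_set1.
Qed.

Section one_point_compactification_discrete.
Variable D : discreteTopologicalType.
Local Notation opc := (one_point_compactification D).

Lemma nbhs_infinityP (U : set opc) :
  nbhs (None : opc) U <-> U None /\ finite_set [set d | ~ U (Some d)].
Proof.
split=> [[K [/discrete_compact_finite K_finite _] KU]|[UN U_finite]].
  split; first by apply: KU; right.
  by apply: sub_finite_set K_finite => d nUd; apply: contrapT => nKd;
    apply: nUd; apply: KU; left; exists d.
exists [set d | ~ U (Some d)].
  by split; [exact/discrete_compact_finite|exact: discrete_closed].
by move=> _ [[d /contrapT Ud <-]|->].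
Qed.

Lemma nbhs_isolated (d : D) : nbhs (Some d : opc) [set Some d].
Proof.
by have := one_point_compactification_some_nbhs _ _ (discrete_set1 d);
  rewrite image_set1.
Qed.

Lemma cvg_infinityP (x_ : nat -> opc) : x_ @ \oo --> (None : opc) <->
  forall d, finite_set [set n | x_ n = Some d].
Proof.
split=> [x_cvg d|x_fin U /nbhs_infinityP[UN U_finite]].
  have /x_cvg/near_oo_cofinite : nbhs (None : opc) (~` [set Some d]).
    apply/nbhs_infinityP; split => //.
    by apply: sub_finite_set (finite_set1 d) => e /contrapT[].
  by apply: sub_finite_set => n /= ->; exact.
apply/near_oo_cofinite.
apply: sub_finite_set (bigcup_finite U_finite (fun d _ => x_fin d)) => n.
rewrite /preimage/=; case xn: (x_ n) => [d|] nU; first by exists d.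
by case: nU.
Qed.

End one_point_compactification_discrete.

(* [Q] is either the cofinite or the infinite sets, giving cs-networks and
   cs*-networks respectively. *)
Definition network (Q : set (set nat)) (X : topologicalType) (x : X)
    (N : set (set X)) : Prop :=
  forall (U : set X) (x_ : nat -> X), nbhs x U -> x_ @ \oo --> x ->
    exists A, [/\ N A, A `<=` U & Q [set n | A (x_ n)]].

Lemma sub_network (Q Q' : set (set nat)) (X : topologicalType) (x : X) N :
  Q `<=` Q' -> network Q x N -> network Q' x N.
Proof.
move=> QQ' netN U x_ xU x_cvg; have [A [NA AU QA]] := netN U x_ xU x_cvg.
by exists A; split => //; exact: QQ'.
Qed.

(** Open sets of the subspace are traces of open sets of [X], so its discreteness can be tested
    inside [X]. *)
Lemma discrete_subspaceP (X : topologicalType) (C : set X) :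
  discrete_space (set_type C) <->
  forall x, C x -> exists2 G, open_nbhs x G & G `&` C `<=` [set x].
Proof.
split=> [C_discrete x Cx|isolated].
  pose y : set_type C := SigSub (mem_set Cx).
  have : nbhs y [set y] by rewrite C_discrete; exact/principal_filterP.
  rewrite nbhsE => -[V [[G oG GV] Vy] Vsub].
  have Gx : G x by have : (set_val @^-1` G) y by rewrite GV.
  exists G => // z [Gz Cz].
  have /Vsub/(congr1 val)// : V (SigSub (mem_set Cz)) by rewrite -GV.
rewrite /discrete_space funeqE => y; apply/seteqP; split=> U.
  by move=> /nbhs_singleton Uy; exact/principal_filterP.
move=> /principal_filterP Uy.
have [G [oG Gy] GC] := isolated (val y) (set_valP y).
rewrite nbhsE; exists (set_val @^-1` G); first by split => //; exists G.
move=> z Gz; suff -> : z = y by [].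
by apply: val_inj; apply: GC; split => //; exact: set_valP.
Qed.

(** * From bases to networks *)

Section complement_network.
Variables (D : discreteTopologicalType) (X : topologicalType) (phi : D -> X).
Variable B : set (set X).
Hypotheses (phi_inj : injective phi) (B_basis : basis B).
Local Notation opc := (one_point_compactification D).

(** Finite unions are indexed by lists so that [card_le_seq] bounds their number. *)
Definition union_of (s : seq (set_type B)) : set X :=
  foldr (fun U V => val U `|` V) set0 s.

Definition traces (s : seq (set_type B)) : set opc :=
  Some @` (phi @^-1` union_of s).

Definition complement_network : set (set opc) := range (fun s => ~` traces s).

Lemma traces_cons U s :
  traces (U :: s) = Some @` (phi @^-1` val U) `|` traces s.
Proof. by rewrite /traces -image_setU. Qed.

Lemma card_complement_network : infinite_set B -> complement_network #<= B.
Proof.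
move=> B_infinite; rewrite -(card_le_eqr (card_setT B)).
have inf : infinite_set [set: set_type B].
  by rewrite (eq_finite_set (card_setT B)).
exact: card_le_trans (card_image_le _ _) (card_le_seq inf (card_lexx _)).
Qed.

Lemma basis_nbhs x V : nbhs x V ->
  exists U : set_type B, val U x /\ val U `<=` V.
Proof.
case: B_basis => _ /(_ x) /(_ V) /[apply] -[U [BU Ux] UV].
by exists (SigSub (mem_set BU)).
Qed.

(** A neighborhood of infinity omits only a finite list [l] of points of [D], so it contains the
    complement of any union covering [l]. It remains to cover [l] while leaving enough terms of the
    sequence uncovered. *)
Lemma complement_networkP Q :
  (forall (x_ : nat -> opc), x_ @ \oo --> (None : opc) -> forall l : seq D,
    exists2 s, (forall d, d \in l -> union_of s (phi d)) &
      Q [set n | ~ traces s (x_ n)]) ->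
  network Q (None : opc) complement_network.
Proof.
move=> avoid U x_ /nbhs_infinityP[UN /finite_seqP[l lE]] x_cvg.
have [s ls Qs] := avoid x_ x_cvg l.
exists (~` traces s); split=> //; first by exists s.
move=> [d|//] sd; apply: contrapT => nUd; apply: sd; exists d => //.
by apply: ls; have : [set d | ~ U (Some d)] d by []; rewrite lE.
Qed.

(** Induction on the list: the values of the sequence together with [d] form a countable, hence
    discrete, subspace, so some basic neighborhood of [phi d] captures only the finitely many terms
    equal to [d]. *)
Lemma cs_complement_network : no_countable_nondiscrete_subspace X ->
  network (fun S => cofinite_set S) (None : opc) complement_network.
Proof.
move=> X_discrete; apply: complement_networkP => x_ x_cvg.
have x_fin := iffLR (cvg_infinityP x_) x_cvg.
elim=> [|d l [s ls s_fin]].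
  exists [::] => //.
  by apply: sub_finite_set (finite_set0 nat) => n /contrapT[].
(* The index [None] yields [phi d], and so do the terms at infinity. *)
pose C := range (fun o : option nat => phi (odflt d (obind x_ o))).
have /X_discrete/discrete_subspaceP : countable C.
  exact: sub_countable (card_image_le _ _) (countableP _).
move=> /(_ (phi d))[|G Gphi GC]; first by exists None.
have [U [Ud UG]] := basis_nbhs (open_nbhs_nbhs Gphi).
exists (U :: s).
  by move=> e; rewrite inE => /predU1P[->|/ls]; [left|right].
have fin : finite_set ([set n | x_ n = Some d] `|`
    ~` [set n | ~ traces s (x_ n)]).
  by rewrite finite_setU.
apply: sub_finite_set fin => n /contrapT.
rewrite traces_cons => -[[c Uc xn]|sn]; last by right => /(_ sn).
left => /=; rewrite -xn; congr Some; apply: phi_inj; apply: GC; split.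
  exact: UG.
by exists (Some n) => //=; rewrite -xn.
Qed.

(** Induction on the list: if every basic neighborhood of [phi d] captured almost all terms left
    uncovered so far, these would form a sequence converging to [phi d], hence eventually constant,
    although each point of [D] is taken only finitely often. *)
Lemma cs_star_complement_network : no_nontrivial_convergent_sequence X ->
  network (fun S => infinite_set S) (None : opc) complement_network.
Proof.
move=> X_trivial; apply: complement_networkP => x_ x_cvg.
have x_fin := iffLR (cvg_infinityP x_) x_cvg.
elim=> [|d l [s ls s_inf]].
  exists [::] => //; apply: sub_infinite_set infinite_nat.
  by move=> n _ [].
suff [U Ud U_inf] : exists2 U : set_type B, val U (phi d) &
    infinite_set [set n | ~ traces s (x_ n) /\
      ~ (Some @` (phi @^-1` val U)) (x_ n)].
  exists (U :: s).
    by move=> e; rewrite inE => /predU1P[->|/ls]; [left|right].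
  apply: sub_infinite_set U_inf => n [ns nU].
  by rewrite /= traces_cons => -[].
apply: contrapT => noU.
have U_fin (U : set_type B) : val U (phi d) ->
    finite_set [set n | ~ traces s (x_ n) /\
      ~ (Some @` (phi @^-1` val U)) (x_ n)].
  by move=> Ud; apply: contrapT => U_inf; apply: noU; exists U.
have [e [es e_inj]] := card_le_fun 0%N (iffLR (infiniteP _) s_inf).
have {}e_inj : injective e by move=> m n; exact: e_inj.
have U_fin' (U : set_type B) : val U (phi d) ->
    finite_set [set n | ~ (Some @` (phi @^-1` val U)) (x_ (e n))].
  move=> /U_fin/finite_preimage => /(_ _ e (in2W e_inj)).
  by apply: sub_finite_set => n ne; split => //; exact: es.
(* Traces do not contain infinity, so a single basic neighborhood shows that almost all terms lie in
   [D]; the default [phi d] in [z] thus concerns finitely many terms. *)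
have [U0 [U0d _]] := basis_nbhs (@filterT _ (nbhs (phi d)) _).
have None_fin : finite_set [set n | x_ (e n) = None].
  by apply: sub_finite_set (U_fin' _ U0d) => n /= -> [].
pose z n := if x_ (e n) is Some c then phi c else phi d.
have [y /near_oo_cofinite y_fin] : exists y, \forall n \near \oo, z n = y.
  apply: (X_trivial z (phi d)) => V /basis_nbhs[U [Ud UV]].
  apply/near_oo_cofinite; apply: sub_finite_set (U_fin' _ Ud) => n nV [c Uc xc].
  by apply: nV; apply: UV; rewrite /z -xc.
have tail_infinite : infinite_set [set n | z n = y /\ x_ (e n) <> None].
  move=> fin; apply: infinite_nat.
  have : finite_set ([set n | z n = y /\ x_ (e n) <> None] `|`
      (~` [set n | z n = y] `|` [set n | x_ (e n) = None])).
    by rewrite !finite_setU.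
  apply: sub_finite_set => n _.
  have [zn|] := pselect (z n = y); last by right; left.
  by have [xn|] := pselect (x_ (e n) = None); [right; right|left].
have [n0 [zn0 xn0]] := infinite_setN0 tail_infinite.
move: zn0 xn0; rewrite /z; case: (x_ (e n0)) => // c0 phic0 _.
apply: tail_infinite.
have := finite_preimage (in2W e_inj) (x_fin c0).
apply: sub_finite_set => n /= [].
rewrite /z; case: (x_ (e n)) => // c; rewrite -phic0 => /phi_inj->//.
Qed.

End complement_network.

(** * From networks to topologies *)

(* The topology on T with subbase b. *)
Definition generated (T : choiceType) (C : Type) (b : C -> set T) : Type := T.

Section generated_topology.
Variables (T : choiceType) (C : Type) (b : C -> set T).
Local Notation G := (generated b).

Definition meet_of (s : seq C) : set T := foldr (fun c V => b c `&` V) setT s.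

Lemma meet_of_cat s t : meet_of (s ++ t) = meet_of s `&` meet_of t.
Proof. by elim: s => [|c s /= ->]; rewrite ?setTI// setIA. Qed.

Definition generated_nbhs (x : G) : set_system G :=
  filter_from [set s | meet_of s x] meet_of.

HB.instance Definition _ := Choice.on G.
HB.instance Definition _ := hasNbhs.Build G generated_nbhs.

Let generated_nbhs_filter (x : G) : ProperFilter (nbhs x).
Proof.
apply: filter_from_proper => [|s sx]; last by exists x.
apply: filter_from_filter => [|s t sx tx]; first by exists [::].
by exists (s ++ t); rewrite /= meet_of_cat.
Qed.

Let generated_nbhs_singleton (x : G) (A : set G) : nbhs x A -> A x.
Proof. by move=> [s sx]; exact. Qed.

Let generated_nbhs_nbhs (x : G) (A : set G) : nbhs x A -> nbhs x (nbhs^~ A).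
Proof. by move=> [s sx sA]; exists s => // y sy; exists s. Qed.

HB.instance Definition _ := @Nbhs_isNbhsTopological.Build G
  generated_nbhs_filter generated_nbhs_singleton generated_nbhs_nbhs.

Lemma open_meet_of s : open (meet_of s : set G).
Proof. by rewrite openE => x sx; exists s. Qed.

Lemma open_generator c : open (b c : set G).
Proof. by have := @open_meet_of [:: c]; rewrite /= setIT. Qed.

Lemma generated_basis : basis (range meet_of : set (set G)).
Proof.
split=> [_ [s _ <-]|x V [s sx sV]]; first exact: open_meet_of.
by exists (meet_of s) => //; split => //; exists s.
Qed.

Lemma clopen_meet_of s : (forall c, open (~` b c : set G)) ->
  clopen (meet_of s : set G).
Proof.
move=> bC_open; elim: s => [|c s IHs] /=; first exact: clopenT.
apply: clopenI => //; split; first exact: open_generator.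
by rewrite -[b c]setCK; exact: open_closedC.
Qed.

Lemma generated_clopen_basis : (forall c, open (~` b c : set G)) ->
  has_clopen_basis G.
Proof.
move=> bC_open; exists (range meet_of); first exact: generated_basis.
by move=> _ [s _ <-]; exact: clopen_meet_of.
Qed.

End generated_topology.

(** * Separation axioms and bases *)

Lemma clopen_basis_regular (X : topologicalType) :
  has_clopen_basis X -> regular_space X.
Proof.
move=> [B [B_open B_basis] B_clopen] x U /B_basis[V [BV Vx] VU].
have [oV cV] := B_clopen V BV.
exists V; first exact: open_nbhs_nbhs.
by move/closure_id: cV => <-.
Qed.

Lemma accessible_separate (X : topologicalType) (x y : X) :
  accessible_space X -> x <> y -> exists2 V, open_nbhs x V & ~ V y.
Proof.
move=> X_T1 /eqP/X_T1[V [oV /set_mem Vx /set_mem nVy]].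
by exists V.
Qed.

(** In a T1 space a point is determined by the basic sets containing it, so a finite base leaves
    only finitely many points. *)
Lemma accessible_infinite_basis (X : topologicalType) (B : set (set X)) :
  accessible_space X -> infinite_set [set: X] -> basis B -> infinite_set B.
Proof.
move=> X_T1 X_infinite B_basis B_finite; apply: X_infinite.
have : finite_set [set: set (set_type B)].
  by apply: finite_powerset; rewrite (eq_finite_set (card_setT B)).
apply: card_le_finite.
apply: (@card_le_map _ _ (fun x => [set U : set_type B | val U x])) => x y xy.
apply: contrapT => /(accessible_separate X_T1)[V /open_nbhs_nbhs xV nVy].
have [U [Ux UV]] := basis_nbhs B_basis xV.
apply: nVy; apply: UV.
by move: Ux; rewrite -/([set U : set_type B | val U x] U) xy.
Qed.

(** * The topology on [D] attached to a network at infinity *)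

Section network_space.
Variables (D : discreteTopologicalType).
Local Notation opc := (one_point_compactification D).
Variable N : set (set opc).

Definition network_class (d : D) : set D :=
  [set e | forall A, N A -> A (Some d) <-> A (Some e)].

Hypothesis N_net : network (fun S => infinite_set S) (None : opc) N.

Lemma nbhs_infinity_avoid (d : D) : nbhs (None : opc) (~` [set Some d]).
Proof.
apply/nbhs_infinityP; split => //.
by apply: sub_finite_set (finite_set1 d) => e /contrapT[].
Qed.

Lemma cvg_infinity_inj (e : nat -> D) : injective e ->
  (fun n => Some (e n) : opc) @ \oo --> (None : opc).
Proof.
move=> e_inj; apply/cvg_infinityP => d.
by apply: sub_finite_set (finite_preimage (in2W e_inj) (finite_set1 d)) => n [].
Qed.

Lemma network_class_finite d : finite_set (network_class d).
Proof.
apply: contrapT => /infiniteP/(card_le_fun d)[e [e_class e_inj]].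
have {}e_inj : injective e by move=> m n; exact: e_inj.
have [A [NA Ad A_inf]] :=
  N_net (@nbhs_infinity_avoid d) (cvg_infinity_inj e_inj).
have [n /(e_class n I A NA) /Ad] := infinite_setN0 A_inf.
exact.
Qed.

(** Finitely many members would sort the points of [D] into finitely many classes, one of them
    infinite. *)
Lemma network_infinite : infinite_set [set: D] -> infinite_set N.
Proof.
move=> D_infinite N_finite.
have : finite_set [set: set (set_type N)].
  by apply: finite_powerset; rewrite (eq_finite_set (card_setT N)).
pose f (d : D) := [set A : set_type N | val A (Some d)].
move=> /(infinite_fiber f D_infinite)[S S_inf].
have [d dS] := infinite_setN0 S_inf.
apply: S_inf; apply: sub_finite_set (network_class_finite d) => e eS A NA.
have fE : f d = f e by rewrite dS eS.
pose a : set_type N := SigSub (mem_set NA).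
by have -> : A (Some d) = A (Some e) := congr1 (fun S => S a) fE.
Qed.

(* Indistinguishability classes are finite, so a natural number suffices to tell
   their points apart; this keeps D itself as the underlying set, instead of a
   quotient of it. *)
Lemma separating_level : exists lev : D -> nat,
  forall d e, network_class d e -> lev d = lev e -> d = e.
Proof.
(* The numbering depends only on the set [C], so indistinguishable points, whose classes coincide,
   share one numbering. *)
have /choice[g g_inj] : forall C : set D, exists g : D -> nat, finite_set C ->
    forall d e, C d -> C e -> g d = g e -> d = e.
  move=> C; have [/finite_set_countable|nfin] := pselect (finite_set C).
    by move=> /(card_le_fun 0%N)[g [_ g_inj]]; exists g.
  by exists (fun=> 0%N).
exists (fun d => g (network_class d) d) => d e de.
have -> : network_class e = network_class d.
  apply/seteqP; split=> x xe A NA.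
    by rewrite (propext (de A NA)); exact: xe.
  by rewrite -(propext (de A NA)); exact: xe.
apply: g_inj => //; exact: network_class_finite.
Qed.

Variable lev : D -> nat.
Hypothesis lev_sep : forall d e, network_class d e -> lev d = lev e -> d = e.

(** Complements of traces are included to make the traces clopen; level sets partition [D], so the
    complement of one is a union of others. *)
Definition network_generator (c : bool * set_type N + nat) : set D :=
  match c with
  | inl (true, A) => Some @^-1` val A
  | inl (false, A) => ~` (Some @^-1` val A)
  | inr n => lev @^-1` [set n]
  end.

Definition network_space : topologicalType := generated network_generator.
Local Notation X := network_space.

Lemma open_network_generator c : open (network_generator c : set X).
Proof. exact: open_generator. Qed.

Lemma open_setC_network_generator c : open (~` network_generator c : set X).
Proof.
case: c => [[[] A]|n].
- exact: (@open_network_generator (inl (false, A))).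
- by rewrite setCK; exact: (@open_network_generator (inl (true, A))).
- rewrite (_ : ~` _ = \bigcup_(m in ~` [set n]) network_generator (inr m)).
    by apply: bigcup_open => m _; exact: open_network_generator.
  apply/seteqP; split=> [d dn|d [m mn dm] dn]; first by exists (lev d).
  by apply: mn; rewrite -dm -dn.
Qed.

Lemma open_setC_network (A : set opc) : N A ->
  open (~` (Some @^-1` A) : set X).
Proof.
move=> NA.
exact: (@open_network_generator (inl (false, SigSub (mem_set NA)))).
Qed.

Lemma network_space_clopen : has_clopen_basis X.
Proof. exact: generated_clopen_basis open_setC_network_generator. Qed.

(** If every generator containing [x] contains [y], the two points are indistinguishable and have
    the same level, hence are equal. *)
Lemma network_space_accessible : accessible_space X.
Proof.
move=> x y /eqP xy.
suff [c [cx cy]] : exists c, network_generator c x /\ ~ network_generator c y.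
  exists (network_generator c); split;
    [exact: open_network_generator|exact: mem_set|].
  exact: mem_set.
apply: contrapT => /forallNP same; apply: xy.
have {}same c : network_generator c x -> network_generator c y.
  by move=> cx; apply: contrapT => cy; apply: (same c).
apply: lev_sep => [A NA|]; last by apply/esym; exact: (same (inr (lev x))).
split; first exact: (same (inl (true, SigSub (mem_set NA)))).
move=> Ay; apply: contrapT => nAx.
exact: (same (inl (false, SigSub (mem_set NA)))) nAx Ay.
Qed.

Lemma card_network_space_basis : infinite_set N ->
  exists2 B : set (set X), basis B & B #<= N.
Proof.
move=> N_infinite; exists (range (meet_of network_generator)).
  exact: generated_basis.
have inf : infinite_set [set: set_type N].
  by rewrite (eq_finite_set (card_setT N)).
rewrite -(card_le_eqr (card_setT N)).
apply: card_le_trans (card_image_le _ _) (card_le_seq inf _).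
have nat_le := card_le_nat nat inf; have bool_le := card_le_nat bool inf.
exact: card_le_sum (card_le_prod inf bool_le (card_lexx _)) nat_le.
Qed.

(** The terms different from the limit [x] may repeat, but by T1 each value is taken finitely often,
    so if infinitely many they converge to infinity in the compactification. A member of [N] missing
    [x] then contains infinitely many of them, while its complement is a neighborhood of [x]. *)
Lemma network_space_trivial : no_nontrivial_convergent_sequence X.
Proof.
move=> x_ x x_cvg; exists x; apply/near_oo_cofinite.
apply: contrapT => /infiniteP/(card_le_fun 0%N)[s [s_neq s_inj]].
have {}s_inj : injective s by move=> m n; exact: s_inj.
have fin (V : set X) : open_nbhs x V -> finite_set [set n | ~ V (x_ (s n))].
  move=> /open_nbhs_nbhs/x_cvg/near_oo_cofinite.
  exact: finite_preimage (in2W s_inj).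
have cvg : (fun n => Some (x_ (s n)) : opc) @ \oo --> (None : opc).
  apply/cvg_infinityP => d; have [->|/eqP xd] := eqVneq d x.
    by apply: sub_finite_set (finite_set0 _) => n [/(s_neq n I)].
  have [|V xV nVd] :=
    accessible_separate network_space_accessible (x := x) (y := d).
    exact/nesym.
  by apply: sub_finite_set (fin _ xV) => n [/= ->].
have [A [NA Ax A_inf]] := N_net (@nbhs_infinity_avoid x) cvg.
have xA : open_nbhs x (~` (Some @^-1` A) : set X).
  by split; [exact: open_setC_network|move=> /Ax; exact].
by apply: A_inf; apply: sub_finite_set (fin _ xA) => n An; exact.
Qed.

(** It suffices that a neighborhood of [x] meets [C] in a finite set, since T1 removes the other
    points. If [C] minus [x] is infinite, an injective enumeration of it converges to infinity, and
    the complement of a member of [N] missing [x] but containing almost all of it is such a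
    neighborhood. *)
Lemma network_space_discrete :
  network (fun S => cofinite_set S) (None : opc) N ->
  no_countable_nondiscrete_subspace X.
Proof.
move=> N_cs C C_countable; apply/discrete_subspaceP => x Cx.
have [V xV VC_fin] : exists2 V : set X, open_nbhs x V & finite_set (V `&` C).
  have [Cx_fin|Cx_inf] := pselect (finite_set (C `\ x)).
    exists setT; first exact: open_nbhsT.
    by rewrite setTI -(setD1K Cx) finite_setU.
  have : C `\ x #= [set: nat].
    apply: eq_card_nat => //.
    exact: sub_countable (card_le_setD _ _) C_countable.
  move=> /card_set_bijP[f [_ f_inj f_surj]].
  have /choice[e eP] : forall n, exists y, (C `\ x) y /\ f y = n.
    by move=> n; have [y] := f_surj n I; exists y.
  have e_inj : injective e.
    by move=> m n emn; rewrite -(eP m).2 -(eP n).2 emn.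
  have [A [NA Ax A_cofin]] :=
    N_cs _ _ (@nbhs_infinity_avoid x) (cvg_infinity_inj e_inj).
  exists (~` (Some @^-1` A)).
    by split; [exact: open_setC_network|move=> /Ax; exact].
  have : finite_set (x |` e @` (~` [set n | A (Some (e n))])).
    by rewrite finite_setU; split=> //; exact: finite_image.
  apply: sub_finite_set => y [nAy Cy].
  have [->|/eqP yx] := eqVneq y x; [by left|right].
  have ey : e (f y) = y.
    by apply: f_inj; rewrite ?inE; [exact: (eP (f y)).1| |exact: (eP (f y)).2].
  by exists (f y); rewrite /= ey.
pose F := (V `&` C) `\ x.
exists (V `&` ~` F).
  case: xV => oV Vx; split; last by split => // -[_]; exact.
  apply: openI => //; apply: closed_openC.
  apply: (accessible_finite_set_closed.1 network_space_accessible).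
  exact: finite_setD.
by move=> y [[Vy nFy] Cy]; apply: contrapT => yx; apply: nFy.
Qed.

End network_space.

(** * Characters and weights *)

(** Applies [exists_least_type] to the family of all sets satisfying [P], which [N] shows to be
    nonempty. *)
Lemma min_size_exists (T : Type) (P : set T -> Prop) (N : set T) : P N ->
  exists2 N0, P N0 & min_size P (set_type N0) /\
    forall M, P M -> N0 #<= M.
Proof.
move=> PN; pose I := {M : set T | P M}.
have [[N0 PN0] least] :=
  @exists_least_type I (fun i => set_type (sval i)) (inhabits (exist _ N PN)).
have {}least M : P M -> N0 #<= M.
  move=> PM; rewrite -(card_le_eql (card_setT N0)).
  rewrite -(card_le_eqr (card_setT M)).
  exact: least (exist _ M PM).
exists N0 => //; split=> //; split=> [|L [M PM ML]].
  by exists N0 => //; rewrite card_eq_sym; exact: card_setT.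
rewrite (card_le_eql (card_setT N0)) -(card_le_eqr ML).
exact: least.
Qed.

Section characters_and_weights.
Variables (D : discreteTopologicalType) (Q : set (set nat)).
Local Notation opc := (one_point_compactification D).
Hypothesis D_infinite : infinite_set [set: D].
Hypothesis Q_cofinite : (fun S => cofinite_set S) `<=` Q.
Hypothesis Q_infinite : Q `<=` (fun S => infinite_set S).

Lemma network_isolated (d : D) : network Q (Some d : opc) [set [set Some d]].
Proof.
move=> U x_ Ud x_cvg; exists [set Some d]; split=> //.
  by move=> _ ->; exact: nbhs_singleton Ud.
by apply/Q_cofinite/near_oo_cofinite/x_cvg; exact: nbhs_isolated.
Qed.

(** Ensures that a smallest network exists. *)
Lemma network_all (X : topologicalType) (x : X) : network Q x setT.
Proof.
move=> U x_ xU x_cvg; exists U; split => //.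
exact/Q_cofinite/near_oo_cofinite/x_cvg.
Qed.

(** Each base of a space in [P] dominates some network, hence [N]; the base [B] attains this bound.
    Stated for any class [P], it covers both minima. *)
Lemma min_weight_character (P : topologicalType -> Prop) (N : set (set opc))
    (X : topologicalType) (B : set (set X)) :
  (forall M, network Q (None : opc) M -> N #<= M) ->
  (forall (Y : topologicalType) (C : set (set Y)), P Y -> basis C ->
    exists2 M, network Q (None : opc) M & M #<= C) ->
  P X -> basis B -> B #<= N -> min_weight P (set_type N).
Proof.
move=> N_least P_network PX B_basis BN.
have least (Y : topologicalType) (C : set (set Y)) : P Y -> basis C -> N #<= C.
  by move=> PY /(P_network _ _ PY)[M /N_least]; exact: card_le_trans.
split=> [|L [Y PY [[C C_basis CL] _]]]; last first.
  rewrite (card_le_eql (card_setT N)) -(card_le_eqr CL).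
  exact: least C_basis.
exists X => //; split=> [|L [C C_basis CL]].
  exists B => //; rewrite (card_eqr (card_setT N)) card_eq_le BN.
  exact: least B_basis.
rewrite (card_le_eql (card_setT N)) -(card_le_eqr CL).
exact: least C_basis.
Qed.

Variable P : topologicalType -> Prop.
Hypothesis P_network_space : forall (N : set (set opc)) (lev : D -> nat),
  network Q (None : opc) N ->
  (forall d e, network_class N d e -> lev d = lev e -> d = e) ->
  P (network_space N lev).
Hypothesis P_complement_network :
  forall (X : topologicalType) (phi : D -> X) (B : set (set X)),
  injective phi -> basis B -> P X ->
  network Q (None : opc) (complement_network phi B).

(** The common value is the size of a smallest network [N] at infinity, and [network_space N lev]
    realizes both minima. *)
Lemma character_eq_min_weight : exists K : Type,
  [/\ sup_card (fun x : opc => min_size (network Q x)) K,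
      min_weight
        (fun X => [/\ accessible_space X, [set: X] #= [set: D] & P X]) K
    & min_weight (fun X => [/\ regular_space X, has_clopen_basis X,
        accessible_space X, [set: X] #= [set: D] & P X]) K].
Proof.
have [N N_net [N_min N_least]] := min_size_exists (@network_all opc None).
have N_star := sub_network Q_infinite N_net.
have N_infinite := network_infinite N_star D_infinite.
have [lev lev_sep] := separating_level N_star.
have [B B_basis BN] := card_network_space_basis lev N_infinite.
have X_T1 := network_space_accessible lev_sep.
have XP := P_network_space N_net lev_sep.
have X_clopen := network_space_clopen N lev.
have network_of_basis (Y : topologicalType) (C : set (set Y)) :
    accessible_space Y -> [set: Y] #= [set: D] -> P Y -> basis C ->
    exists2 M, network Q (None : opc) M & M #<= C.
  move=> Y_T1 YD PY C_basis.
  have /card_leT_injP[phi phi_inj] : [set: D] #<= [set: Y].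
    by move: YD; rewrite card_eq_le => /andP[].
  exists (complement_network phi C); first exact: P_complement_network.
  apply: card_complement_network.
  apply: accessible_infinite_basis C_basis => //.
  by rewrite (eq_finite_set YD).
exists (set_type N); split.
- split=> [[d|] M M_min|L ub]; last exact: ub N_min.
    (* At an isolated point one set suffices, and [N] is nonempty, so infinity alone decides the
       supremum. *)
    have M_unit : [set: M] #<= [set: unit].
      apply: M_min.2; exists [set [set Some d]]; first exact: network_isolated.
      rewrite (_ : [set: unit] = [set tt]); first exact: eq_card1.
      by apply/seteqP; split=> -[].
    apply: card_le_trans M_unit _; have [A NA] := infinite_setN0 N_infinite.
    apply: (@card_le_map _ _ (fun=> SigSub (mem_set NA))).
    by case; case.
  apply: M_min.2; exists N => //; rewrite card_eq_sym; exact: card_setT.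
- apply: (@min_weight_character _ N _ B) => //.
  by move=> Y C [] *; exact: network_of_basis.
- apply: (@min_weight_character _ N _ B) => //.
    by move=> Y C [] *; exact: network_of_basis.
  by split=> //; exact: clopen_basis_regular.
Qed.

End characters_and_weights.

Theorem proposition8 (D : discreteTopologicalType)
    (D_infinite : infinite_set [set: D]) :
  (exists K : Type,
    [/\ cs_star_character (one_point_compactification D) K,
        min_weight (fun X => [/\ accessible_space X, [set: X] #= [set: D]
          & no_nontrivial_convergent_sequence X]) K
      & min_weight (fun X => [/\ regular_space X, has_clopen_basis X,
          accessible_space X, [set: X] #= [set: D]
          & no_nontrivial_convergent_sequence X]) K]) /\
  (exists K : Type,
    [/\ cs_character (one_point_compactification D) K,
        min_weight (fun X => [/\ accessible_space X, [set: X] #= [set: D]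
          & no_countable_nondiscrete_subspace X]) K
      & min_weight (fun X => [/\ regular_space X, has_clopen_basis X,
          accessible_space X, [set: X] #= [set: D]
          & no_countable_nondiscrete_subspace X]) K]).
Proof.
have cofinite_infinite : (fun S : set nat => cofinite_set S) `<=`
    (fun S => infinite_set S).
  by move=> S; exact: cofinite_set_infinite infinite_nat.
split.
- apply: (character_eq_min_weight D_infinite
    cofinite_infinite (@subset_refl _ _)).
    by move=> N lev N_net lev_sep; exact: network_space_trivial.
  by move=> X phi B phi_inj B_basis; exact: cs_star_complement_network.
- apply: (character_eq_min_weight D_infinite
    (@subset_refl _ _) cofinite_infinite).
    by move=> N lev N_net lev_sep; exact: network_space_discrete.
  by move=> X phi B phi_inj B_basis; exact: cs_complement_network.
Qed.
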